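(* For every $x\in[\tfrac12,1]$, $$\lim_{n\to\infty}\lambda(E_n(x))=\frac{1}{2\ln\frac{10}{9}}\,\ln\frac{5(x+1)}{3(x+2)},$$ where $\lambda$ is Lebesgue measure and $E_n(x)=\{u\in[\tfrac12,1]:\ [0;u_{n+1},u_{n+2},u_{n+3},\dots]<x\}$, with $u=[0;u_1,u_2,u_3,\dots]$, $u_k\in\{\tfrac12,1\}$, the $A_2$-continued fraction expansion of $u$.
   Context: Let $A=\{\tfrac12,1\}$ and $I=[\tfrac12,1]$. For positive reals $a_1,a_2,\dots$, $[0;a_1,a_2,\dots]$ denotes the continued fraction $\cfrac{1}{a_1+\cfrac{1}{a_2+\cdots}}$. Every $x\in I$ has an expansion $x=[0;\alpha_1,\alpha_2,\dots]$ with all $\alpha_k\in A$ (its $A_2$-continued fraction expansion). The expansion is unique except for a countable set of points having exactly two expansions, $[0;b_1,\dots,b_n,\tfrac12,(\tfrac12,1)]=[0;b_1,\dots,b_n,1,(1,\tfrac12)]$ (parentheses denote a period); for these points one of the two expansions is fixed once and for all (the choice does not affect Lebesgue measures). *)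

(* Defs.v *)
(* A sequence (a_k)_{k >= 1} is indexed from 0: [a k] is a_{k+1}. *)
From HB Require Import structures.
From mathcomp Require Import all_boot all_order all_algebra.
From mathcomp Require Import all_classical all_reals all_analysis.

Set Implicit Arguments.
Unset Strict Implicit.
Unset Printing Implicit Defensive.

Import Order.TTheory GRing.Theory Num.Theory.
Import numFieldNormedType.Exports.

Local Open Scope classical_set_scope.
Local Open Scope ring_scope.

(* The finite continued fraction [0; a 0, ..., a (n-1)], equal to 0 for n = 0. *)
Fixpoint cf_convergent (R : realType) (a : nat -> R) (n : nat) : R :=
  if n is m.+1 then (a 0%N + cf_convergent (fun k => a k.+1) m)^-1 else 0.

(* The value [0; a 0, a 1, ...]. The limit exists for every sequence of
   positive reals whose sum diverges, in particular for digits in {1/2, 1}. *)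
Definition cfrac (R : realType) (a : nat -> R) : R :=
  lim (cf_convergent a n @[n --> \oo]).

Definition A2_digits (R : realType) : set R := [set 2^-1; 1].

Definition is_A2_expansion (R : realType) (a : nat -> R) (u : R) : Prop :=
  (forall k, A2_digits (a k)) /\ (cf_convergent a n @[n --> \oo] --> u).

(* [d] fixes one A_2-expansion of each point of [1/2, 1]; it is constrained by
   nothing else, so at a point with two expansions it may pick either one, and
   its values outside [1/2, 1] are irrelevant. *)
Definition A2_expansion_choice (R : realType) (d : R -> nat -> R) : Prop :=
  forall u : R, 2^-1 <= u <= 1 -> is_A2_expansion (d u) u.

(* [d u (n + k)] is the digit u_{n+1+k}, so the tail starts at u_{n+1}. *)
Definition E_set (R : realType) (d : R -> nat -> R) (n : nat) (x : R) : set R :=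
  [set u | 2^-1 <= u <= 1 /\ cfrac (fun k => d u (n + k)%N) < x].

(* Main.v *)
Require Import Defs.
From HB Require Import structures.
From mathcomp Require Import all_boot all_order all_algebra.
From mathcomp Require Import all_classical all_reals all_analysis.
From mathcomp Require Import ring lra.

Set Implicit Arguments.
Unset Strict Implicit.
Unset Printing Implicit Defensive.

Import Order.TTheory GRing.Theory Num.Theory.
Import numFieldNormedType.Exports.

Local Open Scope classical_set_scope.
Local Open Scope ring_scope.

(** Write t_n for the continued fraction of the digits of u after the n-th one,
    so that t_n = 1 / (a + t_(n+1)) with a digit a in {1/2, 1}, and let F_n(x)
    be the measure of the set of u with t_n < x.

    The digit a = 1 sends [1/2, 1] onto [1/2, 2/3], and a = 1/2 sends it onto
    [2/3, 1].  Since the branches only meet at 2/3, up to boundary points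
    t_(n+1) < x means that either 1 / (1 + x) < t_n < 2/3, or
    1 / (1/2 + x) < t_n.  Each boundary condition is an equation t_n = y, which
    has at most 2 ^ n solutions u because u is determined by y and the first n
    digits; so the arbitrary choice of expansions is harmless.  This gives
    [measure_E_set], with a Gauss--Kuzmin recursion [tail_cdf] for the F_n.

    The density of F_n is g_n(x) / ((x + 1) (x + 2)), where the factor
    1 / ((x + 1) (x + 2)) is invariant under the transfer operator.  Hence
    g_(n+1)(x) is a weighted mean of g_n(1 / (1 + x)) and g_n(1 / (1/2 + x)), and
    this averaging multiplies Lipschitz constants by at most 13/16
    ([rel_density_lipschitz]).  So g_n flattens geometrically.  Its limit is
    identified without integrals: with H(x) = ln (5 (x + 1) / (3 (x + 2))), a
    primitive of the invariant density, and c = 1 / (2 ln (10/9)), the function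
    F_n - c H vanishes at 1/2 and at 1, so by Rolle g_n takes the value c
    somewhere.  Then g_n is uniformly close to c, and the mean value theorem
    makes F_n uniformly close to c H ([tail_cdf_error]). *)

(** * Tails of expansions *)

Definition tail (R : realType) (d : R -> nat -> R) (n : nat) (u : R) : R :=
  cfrac (fun k => d u (n + k)%N).

Lemma A2_digits_bounds (R : realType) (a : R) : A2_digits a -> 2^-1 <= a <= 1.
Proof. by case=> ->; lra. Qed.

Lemma cf_convergent_bounds (R : realType) (a : nat -> R) (n : nat) :
  (forall k, A2_digits (a k)) -> 0 <= cf_convergent a n <= 2.
Proof.
elim: n a => [|n IHn] a ha /=; first lra.
have /andP[c0 c2] := IHn (fun k => a k.+1) (fun k => ha k.+1).
have /andP[a0 a1] := A2_digits_bounds (ha 0%N).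
rewrite invr_ge0 invf_ple ?posrE; lra.
Qed.

Lemma cf_convergentS_ge (R : realType) (a : nat -> R) (n : nat) :
  (forall k, A2_digits (a k)) -> 3^-1 <= cf_convergent a n.+1.
Proof.
move=> ha /=.
have /andP[c0 c2] := cf_convergent_bounds n (fun k => ha k.+1).
have /andP[a0 a1] := A2_digits_bounds (ha 0%N).
rewrite lef_pV2 ?posrE; lra.
Qed.

Lemma A2_limit_gt0 (R : realType) (a : nat -> R) (t : R) :
  is_A2_expansion a t -> 0 < t.
Proof.
move=> [ha cv]; apply: (@lt_le_trans _ _ 3^-1); first lra.
move: cv; rewrite -cvg_shiftS => cv; apply: (cvgr_to_ge cv).
by apply: nearW => n; exact: cf_convergentS_ge.
Qed.

(** The continued fraction of the tail converges because one step of the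
    recursion t = 1 / (a + t') can be solved for t'. *)
Lemma is_A2_expansion_behead (R : realType) (a : nat -> R) (t : R) :
  is_A2_expansion a t -> is_A2_expansion (fun k => a k.+1) (t^-1 - a 0%N).
Proof.
move=> ht; have t0 := A2_limit_gt0 ht.
case: ht => ha cv; split=> [k|]; first exact: ha.
move: cv; rewrite -cvg_shiftS => cv.
have -> : cf_convergent (fun k => a k.+1) =
    (fun n => (cf_convergent a n.+1)^-1 - a 0%N).
  by apply/funext => n /=; rewrite invrK addrC addKr.
apply: cvgB; last exact: cvg_cst.
exact: cvgV (lt0r_neq0 t0) cv.
Qed.

(** If every limit is at most 1 + e, inverting 1 + (1 + e) shows that every limit
    is at least 1/2 - e/4; inverting 1/2 + (1/2 - e/4) then shows that every limit
    is at most 1 + e/2.  So the error halves at each step. *)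
Lemma A2_limit_approx (R : realType) (k : nat) (a : nat -> R) (t : R) :
  is_A2_expansion a t ->
  2^-1 - 2^-1 * 2^-1 ^+ k <= t <= 1 + 2^-1 ^+ k.
Proof.
elim: k a t => [|k IHk] a t ht.
  rewrite expr0; case: ht => ha cv; apply/andP; split.
    apply: (cvgr_to_ge cv); apply: nearW => n.
    by have := cf_convergent_bounds n ha; lra.
  apply: (cvgr_to_le cv); apply: nearW => n.
  by have := cf_convergent_bounds n ha; lra.
rewrite exprS; set e := 2^-1 ^+ k.
have e0 : 0 < e by apply: exprn_gt0; lra.
have e1 : e <= 1 by apply: exprn_ile1; lra.
have low b s : is_A2_expansion b s -> 2^-1 - 2^-1 * (2^-1 * e) <= s.
  move=> hs; have /andP[_ +] := IHk _ _ (is_A2_expansion_behead hs).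
  have /andP[_ b1] := A2_digits_bounds (hs.1 0%N); rewrite -/e => s2.
  have s0 := A2_limit_gt0 hs.
  have sV : s^-1 * s = 1 by rewrite mulVf ?gt_eqF.
  have : s^-1 <= 2 + e by lra.
  nra.
apply/andP; split; first exact: low ht.
have := low _ _ (is_A2_expansion_behead ht).
have /andP[a0 _] := A2_digits_bounds (ht.1 0%N) => s1.
have t0 := A2_limit_gt0 ht.
have tV : t^-1 * t = 1 by rewrite mulVf ?gt_eqF.
have : 1 - 2^-1 * (2^-1 * e) <= t^-1 by lra.
nra.
Qed.

Lemma A2_limit_bounds (R : realType) (a : nat -> R) (t : R) :
  is_A2_expansion a t -> 2^-1 <= t <= 1.
Proof.
move=> ht.
have h0 : (2^-1 : R) ^+ k @[k --> \oo] --> (0 : R).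
  by apply: cvg_expr; rewrite ger0_norm; lra.
apply/andP; split.
  have /cvgr_to_le : 2^-1 - 2^-1 * 2^-1 ^+ k @[k --> \oo] --> (2^-1 : R).
    rewrite -[X in _ --> X]subr0 -[X in _ --> _ - X](mulr0 2^-1).
    by apply: cvgB; [exact: cvg_cst|apply: cvgM => //; exact: cvg_cst].
  by apply; apply: nearW => k; have /andP[] := A2_limit_approx k ht.
have /cvgr_to_ge : 1 + 2^-1 ^+ k @[k --> \oo] --> (1 : R).
  by rewrite -[X in _ --> X]addr0; apply: cvgD => //; exact: cvg_cst.
by apply; apply: nearW => k; have /andP[] := A2_limit_approx k ht.
Qed.

Lemma is_A2_expansion_cfrac (R : realType) (a : nat -> R) (t : R) :
  is_A2_expansion a t -> cfrac a = t.
Proof. by case=> _; exact: cvg_lim. Qed.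

Lemma is_A2_expansion_tail (R : realType) (d : R -> nat -> R) (n : nat) (u : R) :
  A2_expansion_choice d -> 2^-1 <= u <= 1 ->
  is_A2_expansion (fun k => d u (n + k)%N) (tail d n u).
Proof.
move=> hd hu; elim: n => [|n IHn].
  by rewrite /tail (is_A2_expansion_cfrac (hd u hu)); exact: hd.
have := is_A2_expansion_behead IHn.
under eq_fun do rewrite addnS -addSn.
by move=> h; rewrite /tail (is_A2_expansion_cfrac h).
Qed.

Lemma tail0 (R : realType) (d : R -> nat -> R) (u : R) :
  A2_expansion_choice d -> 2^-1 <= u <= 1 -> tail d 0 u = u.
Proof. by move=> hd hu; apply: is_A2_expansion_cfrac; exact: hd. Qed.

Lemma tail_bounds (R : realType) (d : R -> nat -> R) (n : nat) (u : R) :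
  A2_expansion_choice d -> 2^-1 <= u <= 1 -> 2^-1 <= tail d n u <= 1.
Proof.
by move=> hd hu; exact: A2_limit_bounds (is_A2_expansion_tail n hd hu).
Qed.

Lemma tailS (R : realType) (d : R -> nat -> R) (n : nat) (u : R) :
  A2_expansion_choice d -> 2^-1 <= u <= 1 ->
  tail d n u = (2^-1 + tail d n.+1 u)^-1 \/ tail d n u = (1 + tail d n.+1 u)^-1.
Proof.
move=> hd hu; have ht := is_A2_expansion_tail n hd hu.
have := is_A2_expansion_behead ht.
under eq_fun do rewrite addnS -addSn.
move=> /is_A2_expansion_cfrac; rewrite -/(tail d n.+1 u) => ->.
by case: (ht.1 0%N) => ->; [left|right]; rewrite addrC subrK invrK.
Qed.

(** * Geometric convergence of the distribution functions *)

(** The measure of the set of u whose n-th tail is below x, by recursion on n; the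
    two differences come from the two possible digits, and 1/2 is the total
    mass. *)
Fixpoint tail_cdf (R : realType) (n : nat) (x : R) : R :=
  if n is m.+1 then
    tail_cdf m (2 / 3) - tail_cdf m (1 + x)^-1
      + (2^-1 - tail_cdf m (2^-1 + x)^-1)
  else x - 2^-1.

(** The density of [tail_cdf] divided by the invariant density
    1 / ((x + 1) (x + 2)).  Invariance is what makes the two weights add up
    to 1. *)
Fixpoint rel_density (R : realType) (n : nat) (x : R) : R :=
  if n is m.+1 then
    (1 + x) / (3 + 2 * x) * rel_density m (1 + x)^-1
      + (2 + x) / (3 + 2 * x) * rel_density m (2^-1 + x)^-1
  else (x + 1) * (x + 2).

(** The primitive of 1 / ((x + 1) (x + 2)) that vanishes at 1/2. *)
Definition invariant_cdf (R : realType) (x : R) : R :=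
  ln (5 * (x + 1) / (3 * (x + 2))).

Lemma tail_cdf_half (R : realType) (n : nat) :
  tail_cdf n (2^-1) = 0 :> R /\ tail_cdf n 1 = 2^-1 :> R.
Proof.
elim: n => [|n [IH1 IH2]] /=; first by split; lra.
rewrite (_ : (1 + 2^-1)^-1 = 2 / 3 :> R); last by field.
rewrite (_ : (2^-1 + 2^-1)^-1 = 1 :> R); last by field.
rewrite (_ : (1 + 1)^-1 = 2^-1 :> R); last by field.
rewrite (_ : (2^-1 + 1)^-1 = 2 / 3 :> R); last by field.
by rewrite IH1 IH2; split; lra.
Qed.

Lemma is_derive_comp_invD (R : realType) (f : R -> R) (a x df : R) :
  a + x != 0 -> is_derive (a + x)^-1 1 f df ->
  is_derive x 1 (fun y => f (a + y)^-1) (- (df / (a + x) ^+ 2)).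
Proof.
move=> ax hf.
have hD : is_derive x 1 (fun y : R => a + y) 1.
  have : is_derive x 1 (cst a + id : R -> R) (0 + 1) by apply: is_deriveD.
  by rewrite add0r.
have hV := is_deriveV ax hD.
have := @is_derive1_comp _ f (fun y => (a + y)^-1) _ _ _ hf hV.
by rewrite /GRing.scale /= mulr1 mulrN.
Qed.

Lemma is_derive_tail_cdf (R : realType) (n : nat) (x : R) : 0 < x ->
  is_derive x 1 (@tail_cdf R n) (rel_density n x / ((x + 1) * (x + 2))).
Proof.
elim: n x => [|n IHn] x x0.
  rewrite /= divff ?mulf_neq0//; [|lra|lra].
  have : is_derive x 1 (id - cst 2^-1 : R -> R) (1 - 0) by apply: is_deriveB.
  by rewrite subr0.
have h1 := @is_derive_comp_invD _ _ 1 _ _ _ (IHn (1 + x)^-1 _).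
have h2 := @is_derive_comp_invD _ _ 2^-1 _ _ _ (IHn (2^-1 + x)^-1 _).
have {}h1 := h1 ltac:(lra) ltac:(rewrite invr_gt0; lra).
have {}h2 := h2 ltac:(lra) ltac:(rewrite invr_gt0; lra).
have hD := is_deriveD
  (is_deriveB (is_derive_cst (tail_cdf n (2 / 3 : R)) x 1) h1)
  (is_deriveB (is_derive_cst (2^-1 : R) x 1) h2).
apply: is_derive_eq hD _ => /=.
set g1 := rel_density _ _; set g2 := rel_density _ _.
by field; repeat (apply/andP; split); lra.
Qed.

(** The two weighted terms contribute at most 1/6 and 5/8 to the contraction
    factor, by the derivatives of the inverse branches; the variation of the
    weights contributes at most 1/16 * 1/3, because the points 1 / (1 + y) and
    1 / (1/2 + y) are at distance at most 1/3.  The sum is 13/16. *)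
Lemma rel_density_lipschitz (R : realType) (n : nat) (x y : R) :
  2^-1 <= x <= 1 -> 2^-1 <= y <= 1 ->
  `|rel_density n x - rel_density n y| <= 5 * (13 / 16) ^+ n * `|x - y|.
Proof.
elim: n x y => [|n IHn] x y hx hy.
  rewrite /= expr0 mulr1.
  rewrite (_ : _ - _ = (x + y + 3) * (x - y)); last by ring.
  by rewrite normrM ler_wpM2r// ger0_norm; lra.
rewrite exprS.
set M := 5 * _ ^+ n in IHn *.
rewrite [leRHS](_ : _ = 13 / 16 * (M * `|x - y|)); last by rewrite /M; ring.
have M1 : 0 <= M by rewrite mulr_ge0// exprn_ge0//; lra.
have M0 : 0 <= M * `|x - y| by rewrite mulr_ge0.
have inv (a z : R) : 2^-1 <= a <= 1 -> 2^-1 <= z <= 1 -> 2^-1 <= (a + z)^-1 <= 1.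
  by move=> ha hz; rewrite lef_pV2 ?posrE ?invf_le1; lra.
have inv1 z := inv 1 z ltac:(lra).
have inv2 z := inv 2^-1 z ltac:(lra).
have L1 := IHn _ _ (inv1 x hx) (inv1 y hy).
have L2 := IHn _ _ (inv2 x hx) (inv2 y hy).
have L3 := IHn _ _ (inv1 y hy) (inv2 y hy).
have invB (a : R) : 0 < a ->
    `|(a + x)^-1 - (a + y)^-1| = ((a + x) * (a + y))^-1 * `|x - y|.
  move=> a0; have -> : (a + x)^-1 - (a + y)^-1 = ((a + x) * (a + y))^-1 * (y - x).
    by field; repeat (apply/andP; split); lra.
  by rewrite normrM distrC ger0_norm // invr_ge0 mulr_ge0; lra.
have step (c r K a b : R) : 0 <= c -> `|a| <= M * b -> b = r * `|x - y| ->
    c * r <= K -> `|c * a| <= K * (M * `|x - y|).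
  move=> c0 aM bE cr; rewrite normrM (ger0_norm c0).
  apply: le_trans (ler_wpM2l c0 aM) _; rewrite bE.
  rewrite [leLHS](_ : _ = c * r * (M * `|x - y|)); last by ring.
  exact: ler_wpM2r.
rewrite /=.
set g1x := rel_density n (1 + x)^-1 in L1 *.
set g1y := rel_density n (1 + y)^-1 in L1 L3 *.
set g2x := rel_density n (2^-1 + x)^-1 in L2 *.
set g2y := rel_density n (2^-1 + y)^-1 in L2 L3 *.
(* As the weights sum to 1, the difference of the two weighted means only
   involves differences of values of the previous function. *)
rewrite [X in `|X|](_ : _ = (1 + x) / (3 + 2 * x) * (g1x - g1y)
    + (2 + x) / (3 + 2 * x) * (g2x - g2y)
    + ((3 + 2 * x) * (3 + 2 * y))^-1 * ((x - y) * (g1y - g2y)));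
  last by field; repeat (apply/andP; split); lra.
have S1 : `|(1 + x) / (3 + 2 * x) * (g1x - g1y)| <= 6^-1 * (M * `|x - y|).
  apply: step L1 (invB 1 ltac:(lra)) _; first by rewrite divr_ge0; lra.
  rewrite [leLHS](_ : _ = ((3 + 2 * x) * (1 + y))^-1).
    by rewrite lef_pV2 ?posrE; nra.
  by field; repeat (apply/andP; split); lra.
have S2 : `|(2 + x) / (3 + 2 * x) * (g2x - g2y)| <= 5 / 8 * (M * `|x - y|).
  apply: step L2 (invB 2^-1 ltac:(lra)) _; first by rewrite divr_ge0; lra.
  rewrite -[leRHS]mulr1; apply: ler_pM.
  - by rewrite divr_ge0; lra.
  - by rewrite invr_ge0 mulr_ge0; lra.
  - by rewrite ler_pdivrMr; lra.
  - by rewrite invf_le1; nra.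
have S3 : `|((3 + 2 * x) * (3 + 2 * y))^-1 * ((x - y) * (g1y - g2y))|
    <= 48^-1 * (M * `|x - y|).
  have bE : `|(1 + y)^-1 - (2^-1 + y)^-1| <= 3^-1.
    rewrite distrC ger0_norm; last by rewrite subr_ge0 lef_pV2 ?posrE; lra.
    rewrite (_ : _ - _ = (2 * ((1 + y) * (2^-1 + y)))^-1).
      by rewrite lef_pV2 ?posrE; nra.
    by field; repeat (apply/andP; split); lra.
  apply: (@step _ 3^-1 _ _ (3^-1 * `|x - y|)) => //.
  - by rewrite invr_ge0 mulr_ge0; lra.
  - rewrite normrM mulrC mulrA; apply: ler_wpM2r => //.
    by apply: le_trans L3 _; apply: ler_wpM2l.
  - by rewrite -invfM lef_pV2 ?posrE; nra.
apply: le_trans (ler_normD _ _) _; apply: le_trans (lerD (ler_normD _ _) (lexx _)) _.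
lra.
Qed.

Lemma is_derive_invariant_cdf (R : realType) (x : R) : 0 < x ->
  is_derive x 1 (@invariant_cdf R) ((x + 1) * (x + 2))^-1.
Proof.
move=> x0.
have hD (a : R) : is_derive x 1 (fun y : R => y + a) 1.
  have : is_derive x 1 (id + cst a : R -> R) (1 + 0) by apply: is_deriveD.
  by rewrite addr0.
have hf : is_derive x 1 (fun y : R => 5 * (y + 1) / (3 * (y + 2)))
    (5 / 3 / (x + 2) ^+ 2).
  have x2 : x + 2 != 0 by lra.
  have hV := is_deriveV (f := fun y : R => y + 2) x2 (hD 2).
  have h := is_deriveM (is_deriveZ (5 / 3) (hD 1)) hV.
  have -> : (fun y : R => 5 * (y + 1) / (3 * (y + 2))) =
    (5 / 3 \*: (fun y : R => y + 1) : R -> R) * (fun y : R => (y + 2)^-1).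
    apply/funext => y.
    change (5 * (y + 1) / (3 * (y + 2)) = 5 / 3 * (y + 1) / (y + 2)).
    by rewrite invfM; ring.
  apply: is_derive_eq h _.
  change (5 / 3 * (x + 1) * (- (x + 2) ^- 2 * 1) + (x + 2)^-1 * (5 / 3 * 1)
    = 5 / 3 / (x + 2) ^+ 2).
  by field; repeat (apply/andP; split); lra.
have f0 : 0 < 5 * (x + 1) / (3 * (x + 2)) by rewrite divr_gt0; lra.
have -> : @invariant_cdf R =
  @ln R \o (fun y : R => 5 * (y + 1) / (3 * (y + 2))) by [].
have hln : is_derive ((fun y : R => 5 * (y + 1) / (3 * (y + 2))) x) 1 (@ln R)
    (5 * (x + 1) / (3 * (x + 2)))^-1 by exact: is_derive1_ln.
have h := @is_derive1_comp R (@ln R)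
  (fun y : R => 5 * (y + 1) / (3 * (y + 2))) _ _ _ hln hf.
apply: is_derive_eq h _.
by field; repeat (apply/andP; split); lra.
Qed.

(** The error vanishes at both ends of [1/2, 1], so the relative density takes the
    value c = 1 / (2 ln (10/9)) at some z; near-constancy of the relative density
    then bounds the derivative of the error. *)
Lemma tail_cdf_error (R : realType) (n : nat) (x : R) : 2^-1 <= x <= 1 ->
  `|tail_cdf n x - (2 * ln (10 / 9))^-1 * invariant_cdf x|
    <= 5 * (13 / 16) ^+ n.
Proof.
move=> hx; set c := (2 * _)^-1.
pose err (y : R) := tail_cdf n y - c * invariant_cdf y.
have errD (y : R) : 0 < y ->
    is_derive y 1 err ((rel_density n y - c) / ((y + 1) * (y + 2))).
  move=> y0.
  have h := is_deriveB (is_derive_tail_cdf n y0)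
              (is_deriveZ c (is_derive_invariant_cdf y0)).
  by apply: is_derive_eq h _; rewrite /GRing.scale /= -mulrBl.
have errC (b : R) : {within `[2^-1, b], continuous err}.
  apply: derivable_within_continuous => y; rewrite in_itv /= => /andP[y0 _].
  by have [] := errD y ltac:(lra).
have err0 : err 2^-1 = 0.
  rewrite /err (tail_cdf_half R n).1 /invariant_cdf.
  by rewrite (_ : _ / _ = 1 :> R) ?ln1 ?mulr0 ?subr0//; field.
have err1 : err 1 = 0.
  rewrite /err (tail_cdf_half R n).2 /invariant_cdf.
  rewrite (_ : 5 * _ / _ = 10 / 9 :> R); last by field.
  have l0 : 0 < ln (10 / 9 : R) by apply: ln_gt0; lra.
  by rewrite /c; field; lra.
have [z zI ez] := @MVT R err _ (2^-1) 1 ltac:(lra)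
  (fun y hy => errD y ltac:(move: hy; rewrite in_itv /=; lra)) (errC 1).
have hz : 2^-1 <= z <= 1 by move: zI; rewrite in_itv /=; lra.
have gz : rel_density n z = c.
  move: ez; rewrite err0 err1 subrr => /esym/eqP; rewrite !mulf_eq0 invr_eq0 mulf_eq0.
  have -> : (z + 1 == 0) = false by apply/eqP; lra.
  have -> : (z + 2 == 0) = false by apply/eqP; lra.
  have -> : (1 - 2^-1 == 0 :> R) = false by apply/eqP; lra.
  by rewrite !orbF subr_eq0 => /eqP.
have [w wI ew] := @MVT_segment R err _ (2^-1) x ltac:(lra)
  (fun y hy => errD y ltac:(move: hy; rewrite in_itv /=; lra)) (errC x).
have hw : 2^-1 <= w <= 1 by move: wI; rewrite in_itv /=; lra.
rewrite -/(err x) -[err x]subr0 -err0 ew -gz.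
have := rel_density_lipschitz n hw hz.
have q0 : 0 <= (13 / 16 : R) ^+ n by rewrite exprn_ge0//; lra.
have wz : `|w - z| <= 1 by rewrite ler_norml; lra.
have hi : 0 <= ((w + 1) * (w + 2))^-1 <= 1.
  have ? : 1 <= (w + 1) * (w + 2) by nra.
  by rewrite invr_ge0 invf_le1; lra.
rewrite !normrM (ger0_norm (x := _^-1)) ?(ger0_norm (x := x - _)); [|lra|lra].
set D := `|_ - _|; set i := _^-1 in hi *; set q := _ ^+ n in q0 *.
have D0 : 0 <= D by exact: normr_ge0.
move=> hD.
have D5 : D <= 5 * q by nra.
have : D * i <= D by nra.
have : 0 <= D * i by nra.
nra.
Qed.

(** * The measure of the sets of the theorem *)

(** Going back from a tail to the previous one leaves a choice of two digits, so
    the fibre has at most 2 ^ n points. *)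
Lemma finite_tail_fiber (R : realType) (d : R -> nat -> R) (n : nat) (y : R) :
  A2_expansion_choice d ->
  finite_set [set u | 2^-1 <= u <= 1 /\ tail d n u = y].
Proof.
move=> hd; elim: n y => [|n IHn] y.
  apply: (@sub_finite_set _ _ [set y]); last exact: finite_set1.
  by move=> u [hu]; rewrite /= tail0.
apply: sub_finite_set (_ : finite_set
  ([set u | 2^-1 <= u <= 1 /\ tail d n u = (2^-1 + y)^-1] `|`
   [set u | 2^-1 <= u <= 1 /\ tail d n u = (1 + y)^-1])).
  by move=> u [hu <-]; case: (tailS n hd hu) => h; [left|right].
by rewrite finite_setU; split.
Qed.

Lemma measure_eq_mod_finite (R : realType) (A B N : set (measurableTypeR R)) :
  finite_set N -> measurable B -> (forall u, ~ N u -> A u <-> B u) ->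
  measurable A /\ lebesgue_measure A = lebesgue_measure B.
Proof.
move=> fN mB AB.
have mF (C : set (measurableTypeR R)) : finite_set C -> measurable C.
  move=> fC; apply: countable_measurable; first exact: measurable_set1.
  exact: finite_set_countable.
have zF (C : set (measurableTypeR R)) : finite_set C -> lebesgue_measure C = 0%E.
  by move=> fC; apply: countable_lebesgue_measure0; exact: finite_set_countable.
have fNC (C : set (measurableTypeR R)) : finite_set (C `&` N).
  by apply: sub_finite_set fN => u [].
have mBN : measurable (B `\` N) by apply: measurableD => //; exact: mF.
have EA : A = (B `\` N) `|` (A `&` N).
  apply/seteqP; split=> u.
    by move=> Au; have [Nu|Nu] := pselect (N u); [right|left; split=> //; exact/AB].
  by case=> [[Bu Nu]|[]//]; exact/AB.
have EB : B = (B `\` N) `|` (B `&` N).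
  by apply/seteqP; split=> u; [have [Nu|Nu] := pselect (N u); [right|left]|case=> -[]].
split; first by rewrite EA; apply: measurableU => //; exact: mF.
rewrite {1}EA [in RHS]EB !measureU0 //; do ?[exact: mF|exact: zF].
Qed.

(** The excluded points are those where some t_n lies on the boundary of an
    interval: t_n = 2/3 is the only value where the next digit is ambiguous, and
    the other two values separate strict from weak inequalities. *)
Lemma E_setS (R : realType) (d : R -> nat -> R) (n : nat) (x u : R) :
  A2_expansion_choice d -> 2^-1 <= x <= 1 ->
  ~ (2^-1 <= u <= 1 /\ tail d n u = 2 / 3) ->
  ~ (2^-1 <= u <= 1 /\ tail d n u = (1 + x)^-1) ->
  ~ (2^-1 <= u <= 1 /\ tail d n u = (2^-1 + x)^-1) ->
  E_set d n.+1 x u <->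
  ((E_set d n (2 / 3) `\` E_set d n (1 + x)^-1) `|`
   (`[2^-1, 1] `\` E_set d n (2^-1 + x)^-1)) u.
Proof.
move=> hd hx n1 n2 n3.
have lt_inv (a s : R) : 0 < a -> 0 <= s ->
    ((a + x)^-1 < (a + s)^-1) = (s < x).
  by move=> a0 s0; rewrite ltf_pV2 ?posrE ?ltrD2l //; lra.
have [hu|hu] := boolP (2^-1 <= u <= 1); last first.
  have nhu : ~ (2^-1 <= u <= 1) by exact/negP.
  split; first by case.
  by case=> [[[]]//|[]]; rewrite /= in_itv.
have {}n1 : tail d n u <> 2 / 3 by move=> h; exact: n1.
have {}n2 : tail d n u <> (1 + x)^-1 by move=> h; exact: n2.
have {}n3 : tail d n u <> (2^-1 + x)^-1 by move=> h; exact: n3.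
have iI : `[2^-1, 1]%classic u by rewrite /= in_itv.
have hs := tail_bounds n.+1 hd hu.
rewrite /E_set /setD /setU /= -/(tail d n.+1 u) -/(tail d n u).
have third1 (s : R) : 2^-1 <= s <= 1 -> (1 + s)^-1 <= 2 / 3.
  by move=> h; rewrite (_ : 2 / 3 = (1 + 2^-1)^-1); [rewrite lef_pV2 ?posrE; lra|field].
have third2 (s : R) : 2^-1 <= s <= 1 -> 2 / 3 <= (2^-1 + s)^-1.
  by move=> h; rewrite (_ : 2 / 3 = (2^-1 + 1)^-1); [rewrite lef_pV2 ?posrE; lra|field].
have := third1 _ hx; have := third2 _ hx.
have := third1 _ hs; have := third2 _ hs.
have := lt_inv 1 (tail d n.+1 u) ltac:(lra) ltac:(lra).
have := lt_inv 2^-1 (tail d n.+1 u) ltac:(lra) ltac:(lra).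
have := tailS n hd hu.
move: n1 n2 n3 => /eqP n1 /eqP n2 /eqP n3.
set t := tail d n u in n1 n2 n3 *; set s := tail d n.+1 u in hs *.
set i1 := (1 + x)^-1 in n2 *; set i2 := (2^-1 + x)^-1 in n3 *.
case=> tE; rewrite -tE => e2 e1 b2 b1 b3 b4.
  split=> [[_ sx]|]; first by right; split=> // -[_]; move: sx; rewrite -e2; lra.
  case=> [[[_ ?] _]|[_ ns]]; first lra.
  split=> //; rewrite -e2 lt_neqAle eq_sym n3 leNgt.
  by apply/negP => h; apply: ns.
split=> [[_ sx]|].
  left; split; first by split=> //; rewrite lt_neqAle n1; lra.
  by case=> _; move: sx; rewrite -e1; lra.
case=> [[_ ns]|[_ ns]].
  split=> //; rewrite -e1 lt_neqAle eq_sym n2 leNgt.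
  by apply/negP => h; apply: ns.
by exfalso; apply: ns; split=> //; rewrite lt_neqAle n3; lra.
Qed.

Lemma measure_E_set (R : realType) (d : R -> nat -> R) (n : nat) (x : R) :
  A2_expansion_choice d -> 2^-1 <= x <= 1 ->
  measurable (E_set d n x : set (measurableTypeR R)) /\
  lebesgue_measure (E_set d n x) = (tail_cdf n x)%:E.
Proof.
move=> hd; elim: n x => [|n IHn] x hx.
  have -> : E_set d 0 x = `[2^-1, x[%classic.
    apply/seteqP; split=> u; rewrite /E_set /= in_itv /=.
      by move=> [hu]; rewrite -/(tail d 0 u) tail0// => ->; case/andP: hu => ->.
    move=> /andP[u1 ux]; have hu : 2^-1 <= u <= 1 by lra.
    by split=> //; rewrite -/(tail d 0 u) tail0.
  split; first exact: measurable_itv.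
  rewrite lebesgue_measure_itv /= lte_fin.
  by case: ltP => h; congr EFin; lra.
have x1 : 2^-1 <= (1 + x)^-1 <= 2 / 3.
  rewrite (_ : 2 / 3 = (1 + 2^-1)^-1); last by field.
  by rewrite !lef_pV2 ?posrE; lra.
have x2 : 2 / 3 <= (2^-1 + x)^-1 <= 1.
  rewrite (_ : 2 / 3 = (2^-1 + 1)^-1); last by field.
  by rewrite lef_pV2 ?posrE ?invf_le1; lra.
have [m0 l0] := IHn (2 / 3) ltac:(lra).
have [m1 l1] := IHn (1 + x)^-1 ltac:(lra).
have [m2 l2] := IHn (2^-1 + x)^-1 ltac:(lra).
have mI : measurable (`[2^-1, 1]%classic : set (measurableTypeR R)).
  exact: measurable_itv.
have lI : lebesgue_measure (`[2^-1, 1]%classic : set R) = (2^-1)%:E.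
  by rewrite lebesgue_measure_itv /= lte_fin invf_lt1 ?ltr1n//; congr EFin; lra.
have Esub (y z : R) : y <= z -> E_set d n y `<=` E_set d n z.
  by move=> yz u [hu uy]; split=> //; exact: lt_le_trans yz.
have fib y := finite_tail_fiber n y hd.
have mA := measurableD m0 m1; have mB := measurableD mI m2.
have [mE lE] := @measure_eq_mod_finite R (E_set d n.+1 x)
  ((E_set d n (2 / 3) `\` E_set d n (1 + x)^-1) `|`
   (`[2^-1, 1] `\` E_set d n (2^-1 + x)^-1))
  ([set u | 2^-1 <= u <= 1 /\ tail d n u = 2 / 3] `|`
   ([set u | 2^-1 <= u <= 1 /\ tail d n u = (1 + x)^-1] `|`
    [set u | 2^-1 <= u <= 1 /\ tail d n u = (2^-1 + x)^-1]))
  ltac:(by rewrite !finite_setU) (measurableU _ _ mA mB)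
  ltac:(by move=> u /not_orP[h1 /not_orP[h2 h3]]; exact: E_setS).
split=> //; rewrite lE measureU //; last first.
  apply/seteqP; split=> // u [[[hu ut] _] [_]]; apply; split=> //.
  by apply: lt_le_trans ut _; lra.
have lD (A B : set (measurableTypeR R)) a b : measurable A -> measurable B ->
    B `<=` A -> lebesgue_measure A = a%:E -> lebesgue_measure B = b%:E ->
    lebesgue_measure (A `\` B) = (a - b)%:E.
  move=> hA hB BA la lb.
  rewrite measureD //; last by rewrite [X in (X < _)%E]la ltry.
  by rewrite setIidr // [X in (X - _)%E]la [X in (_ - X)%E]lb EFinB.
rewrite [X in (X + _)%E](lD _ _ _ _ m0 m1 _ l0 l1); last by apply: Esub; lra.
rewrite [X in (_ + X)%E](lD _ _ _ _ mI m2 _ lI l2) //.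
by move=> u [hu _]; rewrite /= in_itv.
Qed.

(** * The limit law *)

Theorem mainTheorem1 (R : realType) (d : R -> nat -> R)
    (hd : A2_expansion_choice d) (x : R) (hx : 2^-1 <= x <= 1) :
  (lebesgue_measure (E_set d n x)) @[n --> \oo] -->
    (1 / (2 * ln (10 / 9)) * ln (5 * (x + 1) / (3 * (x + 2))))%:E.
Proof.
under eq_fun do rewrite (measure_E_set _ hd hx).2.
apply: cvg_EFin; first by apply: nearW.
rewrite div1r -/(invariant_cdf x).
set l := _ * invariant_cdf x.
have q1 : `|13 / 16 : R| < 1 by rewrite ger0_norm; lra.
have h0 := @cvg_geometric R 5 _ q1.
apply/subr_cvg0/norm_cvg0P.
apply: (squeeze_cvgr _ (cvg_cst 0) h0).
by apply: nearW => n /=; rewrite normr_ge0 /=; exact: tail_cdf_error.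
Qed.
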